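(* Let $N\ge1$, $d\ge2$, let $\bm{p}=(p_1,\ldots,p_d)$ be a probability distribution with all $p_j>0$, and let $\bm{u}=\{u^{(l)}\}_{l=0}^{d-1}$ be real functions on $\{1,\ldots,d\}$ with $u^{(0)}\equiv1$ and $\sum_{i=1}^d u^{(l)}_iu^{(m)}_ip_i=a_l\delta_{lm}$, $a_l>0$. For $\bm{X}=(X_1,\ldots,X_d)\in\mathbb{Z}_{\ge0}^d$ with $|\bm{X}|=N$ define $U_l=\sum_{j=1}^du_j^{(l)}X_j$, $l=1,\ldots,d-1$. Then for each $\bm{n}=(n_1,\ldots,n_{d-1})\in\mathbb{Z}_{\ge0}^{d-1}$ with $|\bm{n}|\le N$, $Q_{\bm{n}}(\bm{X};\bm{u})$ is a polynomial of degree $|\bm{n}|$ in $(U_1,\ldots,U_{d-1})$ whose only term of maximal degree $|\bm{n}|$ is, up to a nonzero constant factor, $\prod_{k=1}^{d-1}U_k^{n_k}$. That is, there are a polynomial $P\in\mathbb{R}[y_1,\ldots,y_{d-1}]$ (depending on $N,\bm{n},\bm{u}$) and a constant $c\ne0$ such that $Q_{\bm{n}}(\bm{X};\bm{u})=P(U_1,\ldots,U_{d-1})$ for all such $\bm{X}$, and every monomial of $P-c\prod_{k=1}^{d-1}y_k^{n_k}$ has total degree strictly less than $|\bm{n}|$.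
   Context: $|\cdot|$ denotes the sum of entries of a vector. The multivariate Krawtchouk polynomial $Q_{\bm{n}}(\bm{x};\bm{u})$, for $\bm{x}\in\mathbb{Z}_{\ge0}^d$, $|\bm{x}|=N$, is the coefficient of $w_1^{n_1}\cdots w_{d-1}^{n_{d-1}}$ in $$\prod_{j=1}^d\Big(1+\sum_{l=1}^{d-1}w_lu_j^{(l)}\Big)^{x_j}.$$ If $J_1,\ldots,J_N\in\{1,\ldots,d\}$ are the outcomes of $N$ trials and $X_i=|\{k:J_k=i\}|$, then $U_l=\sum_{k=1}^Nu^{(l)}_{J_k}$. *)

(* Defs.v *)
From HB Require Import structures.
From mathcomp Require Import all_boot all_order all_algebra.
From mathcomp Require Import mpoly.

Set Implicit Arguments.
Unset Strict Implicit.
Unset Printing Implicit Defensive.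

Import GRing.Theory.
Local Open Scope ring_scope.

(* Throughout d = r.+1.  A family u : 'I_r.+1 -> 'I_r.+1 -> R stands for       *)
(* u^(0), ..., u^(d-1), with u l j = u^(l)_j.  An index k : 'I_r (for w, n, U  *)
(* and the y variables) is the 0-based version of the usual k+1 in 1..d-1, so  *)
(* it selects the function u (lift ord0 k) = u^(k+1).                          *)

Definition krawtchouk_gen (R : comNzRingType) (r : nat)
    (u : 'I_r.+1 -> 'I_r.+1 -> R) (x : 'I_r.+1 -> nat) : {mpoly R[r]} :=
  \prod_(j < r.+1) (1 + \sum_(l < r) u (lift ord0 l) j *: 'X_l) ^+ x j.

Definition krawtchouk (R : comNzRingType) (r : nat)
    (u : 'I_r.+1 -> 'I_r.+1 -> R) (n : 'X_{1..r}) (x : 'I_r.+1 -> nat) : R :=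
  (krawtchouk_gen u x)@_n.

Definition Ustat (R : comNzRingType) (r : nat)
    (u : 'I_r.+1 -> 'I_r.+1 -> R) (x : 'I_r.+1 -> nat) (l : 'I_r) : R :=
  \sum_(j < r.+1) u (lift ord0 l) j * (x j)%:R.

(* Main.v *)
Require Import Defs.
From HB Require Import structures.
From mathcomp Require Import all_boot all_order all_algebra.
From mathcomp Require Import mpoly ring.

Set Implicit Arguments.
Unset Strict Implicit.
Unset Printing Implicit Defensive.

Import Order.TTheory GRing.Theory Num.Theory.
Local Open Scope ring_scope.

(* Write G = prod_j (1 + L_j)^(x_j) for the generating function, with          *)
(* L_j = sum_l u^(l)_j w_l, and H_j = x_j G / (1 + L_j), which is a polynomial. *)
(* Then dG/dw_k = sum_j u^(k)_j H_j and H_j = x_j G - L_j H_j. By              *)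
(* orthogonality each x_j is an affine function of U once |x| = N, so, by      *)
(* induction on |m|, the coefficient [w^m] H_j equals x_j Q_m up to a          *)
(* polynomial in U of degree at most |m|. Since sum_j u^(k)_j x_j = U_k, this  *)
(* gives (m_k + 1) Q_(m + e_k) = U_k Q_m + (degree at most |m|), from which    *)
(* the leading term is read off inductively.                                   *)

(** Differentiating the generating function G in w_k raises the index by e_k: [krawtchouk_rec]
    expresses (m_k + 1) Q_(m + e_k) through the coefficients of the H_j. Up to lower order, [w^m]
    H_j is x_j Q_m ([poly_stat_krawtchouk_del]), so the step m to m + e_k multiplies the leading
    term by U_k / (m_k + 1), and [krawtchouk_leading] iterates this from Q_0 = 1. Degrees are
    tracked by [poly_stat], relative to the domain |X| = N, because only there do the d - 1
    statistics U determine all d counts ([orth_dual], [poly_stat_count]). *)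

Section PolynomialStatistics.

Context {R : realFieldType} {r : nat} {T : Type}.
Implicit Types (D : T -> Prop) (U : T -> 'I_r -> R) (f g : T -> R).

(* [s] bounds the size, so the degree of the polynomial is less than [s]. *)
Definition poly_stat D U (s : nat) f : Prop :=
  exists2 P : {mpoly R[r]}, (msize P <= s)%N & forall x, D x -> f x = P.@[U x].

Lemma poly_stat_eq D U s f g :
  (forall x, D x -> f x = g x) -> poly_stat D U s f -> poly_stat D U s g.
Proof. by move=> fg [P sP fP]; exists P => // x Dx; rewrite -fg // fP. Qed.

Lemma poly_stat_leq D U s t f :
  (s <= t)%N -> poly_stat D U s f -> poly_stat D U t f.
Proof. by move=> st [P sP fP]; exists P => //; apply: leq_trans sP st. Qed.

Lemma poly_stat0 D U s : poly_stat D U s (fun=> 0).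
Proof. by exists 0 => [|x _]; rewrite ?msize0 ?meval0. Qed.

Lemma poly_stat_const D U c : poly_stat D U 1 (fun=> c).
Proof. by exists c%:MP => [|x _]; rewrite ?msizeC ?mevalC ?leq_b1. Qed.

Lemma poly_stat_var D U k : poly_stat D U 2 (fun x => U x k).
Proof. by exists 'X_k => [|x _]; rewrite ?msizeX ?mdeg1 ?mevalXU. Qed.

Lemma poly_stat_mnm D U (m : 'X_{1..r}) :
  poly_stat D U (mdeg m).+1 (fun x => \prod_k U x k ^+ m k).
Proof. by exists 'X_[m] => [|x _]; rewrite ?msizeX ?mevalX. Qed.

Lemma poly_statD D U s f g :
  poly_stat D U s f -> poly_stat D U s g -> poly_stat D U s (fun x => f x + g x).
Proof.
move=> [P sP fP] [Q sQ gQ]; exists (P + Q) => [|x Dx].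
  by apply: leq_trans (msizeD_le _ _) _; rewrite geq_max sP sQ.
by rewrite mevalD fP ?gQ.
Qed.

Lemma poly_statZ D U s c f :
  poly_stat D U s f -> poly_stat D U s (fun x => c * f x).
Proof.
move=> [P sP fP]; exists (c *: P) => [|x Dx]; last by rewrite mevalZ fP.
exact: leq_trans (msizeZ_le _ _) sP.
Qed.

Lemma poly_statB D U s f g :
  poly_stat D U s f -> poly_stat D U s g -> poly_stat D U s (fun x => f x - g x).
Proof.
move=> Hf Hg; apply: poly_stat_eq (poly_statD Hf (poly_statZ (-1) Hg)) => x _.
by rewrite mulN1r.
Qed.

(** Size is degree plus one, hence the asymmetric bounds: degree at most s times degree below t
    gives degree below s + t. *)
Lemma poly_statM D U s t f g :
  poly_stat D U s.+1 f -> poly_stat D U t g ->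
  poly_stat D U (s + t) (fun x => f x * g x).
Proof.
move=> [P sP fP] [Q sQ gQ]; exists (P * Q) => [|x Dx]; last first.
  by rewrite mevalM fP ?gQ.
have [->|P0] := eqVneq P 0; first by rewrite mul0r msize0.
have [->|Q0] := eqVneq Q 0; first by rewrite mulr0 msize0.
rewrite msizeM // -ltnS prednK; first exact: leq_add sP sQ.
by rewrite addn_gt0 lt0n mmeasure_poly_eq0 P0.
Qed.

Lemma poly_stat_sum (I : Type) (e : seq I) D U s (f : I -> T -> R) :
  (forall i, poly_stat D U s (f i)) ->
  poly_stat D U s (fun x => \sum_(i <- e) f i x).
Proof.
move=> Hf; elim: e => [|i e IHe].
  by apply: poly_stat_eq (poly_stat0 D U s) => x _; rewrite big_nil.
by apply: poly_stat_eq (poly_statD (Hf i) IHe) => x _; rewrite big_cons.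
Qed.

End PolynomialStatistics.

Section MPolyComplements.

Context {R : comNzRingType} {r : nat}.
Implicit Types (p : {mpoly R[r]}) (m : 'X_{1..r}).

(** The test guards against truncated subtraction, which would leave m unchanged when its l-th
    exponent is 0. *)
Lemma mcoeffMXU p (l : 'I_r) m :
  (p * 'X_l)@_m = if (0 < m l)%N then p@_(m - U_(l)) else 0.
Proof.
case: ifPn => [m_gt0|].
  have {1}-> : m = (U_(l) + (m - U_(l)))%MM by rewrite addmC submK // lep1mP -lt0n.
  by rewrite mcoeffMX.
rewrite -eqn0Ngt => /eqP ml0; rewrite mcoeffM big1 // => k /eqP mE.
rewrite mcoeffX; case: eqP => [kE|_]; last by rewrite mulr0.
by have /mnmP/(_ l) := mE; rewrite ml0 mnmDE -kE mnm1E eqxx addn1.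
Qed.

Lemma mderivXn (k : 'I_r) p n : (p ^+ n)^`M(k) = n%:R *: (p ^+ n.-1 * p^`M(k)).
Proof.
elim: n => [|n IHn]; first by rewrite expr0 -mpolyC1 mderivC scale0r.
rewrite exprS mderivM IHn /= -scalerAr mulrA -(exprS p n.-1) mulrC.
case: n {IHn} => [|n]; first by rewrite scale0r addr0 scale1r.
by rewrite -{1}[_ * _]scale1r -scalerDl -(natrD _ 1).
Qed.

Lemma mderiv_prod (I : eqType) (k : 'I_r) (e : seq I) (F : I -> {mpoly R[r]}) :
  uniq e ->
  (\prod_(i <- e) F i)^`M(k) =
  \sum_(i <- e) (F i)^`M(k) * \prod_(j <- e | j != i) F j.
Proof.
elim: e => [_|i e IHe /= /andP[ie ue]].
  by rewrite !big_nil -mpolyC1 mderivC.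
rewrite !big_cons mderivM IHe // eqxx /= mulr_sumr.
have -> : \prod_(j <- e | j != i) F j = \prod_(j <- e) F j.
  rewrite [RHS]big_seq big_seq_cond; apply: eq_bigl => j.
  by case: eqP => [->|]; rewrite ?andbT ?(negPf ie).
congr (_ + _); apply: eq_big_seq => j je.
have ij : i != j by apply: contraNneq ie => ->.
by rewrite big_cons ij mulrCA.
Qed.

End MPolyComplements.

Section Recurrence.

Context {R : comNzRingType} {r : nat}.
Variable u : 'I_r.+1 -> 'I_r.+1 -> R.
Implicit Types (x : 'I_r.+1 -> nat) (m : 'X_{1..r}).

Definition krawtchouk_factor j : {mpoly R[r]} :=
  1 + \sum_(l < r) u (lift ord0 l) j *: 'X_l.

(* The polynomial [x_j G / (1 + L_j)]. *)
Definition krawtchouk_del x j : {mpoly R[r]} :=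
  (x j)%:R *: (krawtchouk_factor j ^+ (x j).-1 *
               \prod_(i < r.+1 | i != j) krawtchouk_factor i ^+ x i).

Lemma krawtchouk_factor_del x j :
  krawtchouk_factor j * krawtchouk_del x j = (x j)%:R *: krawtchouk_gen u x.
Proof.
rewrite /krawtchouk_del /krawtchouk_gen -scalerAr [in RHS](bigD1 j) //=.
(* For x_j = 0 the truncated exponent is harmless, since the scalar x_j kills both sides. *)
case: (x j) => [|n]; first by rewrite !scale0r.
by rewrite /= mulrA -exprS.
Qed.

Lemma mderiv_krawtchouk_gen x k :
  (krawtchouk_gen u x)^`M(k) =
  \sum_j u (lift ord0 k) j *: krawtchouk_del x j.
Proof.
rewrite [LHS]mderiv_prod ?index_enum_uniq //; apply: eq_bigr => j _.
rewrite mderivXn -/(krawtchouk_factor j) /krawtchouk_del.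
have -> : (krawtchouk_factor j)^`M(k) = (u (lift ord0 k) j)%:MP.
  rewrite mderivD -mpolyC1 mderivC add0r raddf_sum /= (bigD1 k) //= big1 => [|l lk].
    rewrite addr0 mderivZ mderivX mnm1E eqxx scale1r.
    by rewrite -{1}[U_(k)%MM]add0m addmK mpolyX0 alg_mpolyC.
  by rewrite mderivZ mderivX mnm1E (negPf lk) scale0r scaler0.
by rewrite [_ * _%:MP]mulrC mul_mpolyC -!scalerAl !scalerA mulrC.
Qed.

(** Solves (1 + L_j) H_j = x_j G for H_j; as L_j has no constant term, the sum involves only
    coefficients of H_j of degree |m| - 1. *)
Lemma mcoeff_krawtchouk_del x j m :
  (krawtchouk_del x j)@_m = (x j)%:R * krawtchouk u m x -
    \sum_(l < r) u (lift ord0 l) j * (krawtchouk_del x j * 'X_l)@_m.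
Proof.
apply/(canRL (addrK _)); rewrite -mcoeffZ -krawtchouk_factor_del.
rewrite mulrDl mul1r mcoeffD mulr_suml raddf_sum; congr (_ + _).
by apply: eq_bigr => l _; rewrite /= -[in RHS]scalerAl [in RHS]mcoeffZ (mulrC 'X_l).
Qed.

Lemma krawtchouk_rec x k m :
  krawtchouk u (m + U_(k)) x *+ (m k).+1 =
  \sum_j u (lift ord0 k) j * (krawtchouk_del x j)@_m.
Proof.
rewrite -mcoeff_mderiv mderiv_krawtchouk_gen raddf_sum /=.
by apply: eq_bigr => j _; rewrite mcoeffZ.
Qed.

End Recurrence.

(** Orthogonality says A B = 1 for square matrices; then B A = 1, which is the dual orthogonality of
    the columns. *)
Lemma orth_dual (R : realFieldType) (n : nat) (p : 'I_n -> R)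
    (u : 'I_n -> 'I_n -> R) (a : 'I_n -> R) :
  (forall l, 0 < a l) ->
  (forall l m, \sum_i u l i * u m i * p i = a l * (l == m)%:R) ->
  forall i j, \sum_l p i * u l i * (u l j / a l) = (i == j)%:R.
Proof.
move=> a_gt0 u_orth i j.
pose A := \matrix_(l < n, i < n) (u l i / a l).
pose B := \matrix_(i < n, l < n) (p i * u l i).
have /mulmx1C/matrixP/(_ i j) : A *m B = 1%:M.
  apply/matrixP => l m; rewrite !mxE.
  have -> : (l == m)%:R = (a l)^-1 * \sum_i u l i * u m i * p i.
    by rewrite u_orth mulKf // gt_eqF.
  by rewrite mulr_sumr; apply: eq_bigr => k _; rewrite !mxE; ring.
by rewrite !mxE => <-; apply: eq_bigr => l _; rewrite !mxE.
Qed.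

Section LeadingTerm.

Context {R : realFieldType} {N r : nat}.
Variables (p : 'I_r.+1 -> R) (u : 'I_r.+1 -> 'I_r.+1 -> R) (a : 'I_r.+1 -> R).
Hypothesis u0 : forall j, u ord0 j = 1.
Hypothesis a_gt0 : forall l, 0 < a l.
Hypothesis u_orth : forall l m,
  \sum_(i < r.+1) u l i * u m i * p i = a l * (l == m)%:R.

Let D (X : 'I_r.+1 -> nat) := (\sum_(j < r.+1) X j)%N = N.
Let stat := poly_stat D (Ustat u).

(** Dual orthogonality inverts the map from X to U; the missing statistic, for l = 0, is the
    constant |X| = N. *)
Lemma poly_stat_count j : stat 2 (fun X => (X j)%:R).
Proof.
pose g (X : 'I_r.+1 -> nat) := p j * u ord0 j / a ord0 * N%:R +
  \sum_(l < r) p j * u (lift ord0 l) j / a (lift ord0 l) * Ustat u X l.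
apply: (@poly_stat_eq _ _ _ _ _ _ g) => [X DX|].
  transitivity (\sum_l p j * u l j / a l * \sum_i u l i * (X i)%:R).
    rewrite big_ord_recl; congr (_ * _ + _).
    by rewrite -DX natr_sum; apply: eq_bigr => i _; rewrite u0 mul1r.
  under eq_bigr do rewrite mulr_sumr.
  rewrite exchange_big /=.
  transitivity (\sum_i (j == i)%:R * (X i)%:R : R).
    apply: eq_bigr => i _; rewrite -(orth_dual a_gt0 u_orth) mulr_suml.
    by apply: eq_bigr => l _; ring.
  rewrite (bigD1 j) //= eqxx mul1r big1 ?addr0 // => i ij.
  by rewrite eq_sym (negPf ij) mul0r.
apply: poly_statD; last first.
  by apply: poly_stat_sum => l; apply/poly_statZ/poly_stat_var.
exact: poly_stat_leq (poly_stat_const _ _ _).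
Qed.

(** After x_j Q_m cancels, only coefficients of H_j at indices m - e_l remain. The bounds on Q are a
    premise so that the induction for the leading term can supply them. *)
Lemma poly_stat_krawtchouk_del j m :
  (forall m', (mdeg m' <= mdeg m)%N -> stat (mdeg m').+1 (krawtchouk u m')) ->
  stat (mdeg m).+1
    (fun X => (krawtchouk_del u X j)@_m - (X j)%:R * krawtchouk u m X).
Proof.
have [s] := ubnP (mdeg m); elim: s m => // s IHs m; rewrite ltnS => ms statQ.
pose g (l : 'I_r) X := u (lift ord0 l) j * (krawtchouk_del u X j * 'X_l)@_m.
apply: (@poly_stat_eq _ _ _ _ _ _ (fun X => 0 - \sum_l g l X)) => [X _|].
  by rewrite [in RHS]mcoeff_krawtchouk_del addrAC subrr.
apply: poly_statB; first exact: poly_stat0.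
apply: poly_stat_sum => l; apply: poly_statZ; rewrite -/stat.
have [ml|ml] := ltnP 0 (m l); last first.
  apply: poly_stat_eq (poly_stat0 _ _ _) => X _.
  by rewrite mcoeffMXU ltnNge ml.
have mE : m = (m - U_(l) + U_(l))%MM by rewrite submK // lep1mP -lt0n.
have mdegE : mdeg m = (mdeg (m - U_(l))).+1 by rewrite {1}mE mdegD mdeg1 addn1.
set m' := (m - U_(l))%MM in mE mdegE.
(* The first summand has degree at most |m'| by induction; the factor x_j brings the second up to
   |m'| + 1 = |m|. *)
pose h X := ((krawtchouk_del u X j)@_m' - (X j)%:R * krawtchouk u m' X)
            + (X j)%:R * krawtchouk u m' X.
apply: (@poly_stat_eq _ _ _ _ _ _ h) => [X _|].
  by rewrite mcoeffMXU ml /h subrK.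
apply: poly_statD.
  apply: (@poly_stat_leq _ _ _ _ _ (mdeg m').+1); first by rewrite mdegE leqW.
  apply: IHs => [|m'' m''m']; first by rewrite -mdegE.
  by apply: statQ; rewrite mdegE leqW.
rewrite mdegE -(add1n (_.+1)); apply: poly_statM; first exact: poly_stat_count.
by apply: statQ; rewrite mdegE.
Qed.

(** Size at most |n| means degree strictly below |n|; for n = 0 the remainder must vanish. *)
Lemma krawtchouk_leading n : exists2 c : R, c != 0 &
  stat (mdeg n)
    (fun X => krawtchouk u n X - c * \prod_(k < r) Ustat u X k ^+ n k).
Proof.
have [s] := ubnP (mdeg n); elim: s n => // s IHs n; rewrite ltnS => ns.
have [->|n0] := eqVneq n 0%MM.
  exists 1; first exact: oner_neq0.
  apply: poly_stat_eq (poly_stat0 _ _ _) => X _.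
  rewrite big1 => [|k _]; last by rewrite mnm0E.
  rewrite /krawtchouk /krawtchouk_gen mulr1.
  suff -> : forall Y : 'I_r.+1 -> nat, (krawtchouk_gen u Y)@_0 = 1 by rewrite subrr.
  move=> Y; rewrite /krawtchouk_gen rmorph_prod big1 //= => i _.
  rewrite rmorphXn /= rmorphD /= mcoeff1 eqxx raddf_sum big1 ?addr0 ?expr1n //= => l _.
  by rewrite mcoeffZ mcoeffX mnm1_eq0 mulr0.
have /existsP[k nk] : [exists k, (0 < n k)%N].
  apply: contraR n0 => /existsPn nk; apply/eqP/mnmP => k.
  by rewrite mnm0E; apply/eqP; rewrite -leqn0 leqNgt.
have nE : n = (n - U_(k) + U_(k))%MM by rewrite submK // lep1mP -lt0n.
set m := (n - U_(k))%MM in nE.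
have degE : mdeg n = (mdeg m).+1 by rewrite nE mdegD mdeg1 addn1.
have ms : (mdeg m < s)%N by rewrite -degE.
(* Adding the leading monomial back to the remainder bounds the degree of each earlier Q by its
   index. *)
have statQ m' : (mdeg m' <= mdeg m)%N -> stat (mdeg m').+1 (krawtchouk u m').
  move=> m'm; have [c _ Hc] := IHs m' (leq_ltn_trans m'm ms).
  have := poly_statD (poly_stat_leq (leqnSn _) Hc)
                     (poly_statZ c (poly_stat_mnm D (Ustat u) m')).
  by apply: poly_stat_eq => X _; rewrite subrK.
have [c c0 Hc] := IHs m ms.
have q0 : (m k).+1%:R != 0 :> R by rewrite pnatr_eq0.
exists (c / (m k).+1%:R); first by rewrite mulf_neq0 ?invr_eq0.
pose e j X := (krawtchouk_del u X j)@_m - (X j)%:R * krawtchouk u m X.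
pose g X := (m k).+1%:R^-1 * (\sum_j u (lift ord0 k) j * e j X +
  Ustat u X k * (krawtchouk u m X - c * \prod_(k < r) Ustat u X k ^+ m k)).
apply: (@poly_stat_eq _ _ _ _ _ _ g) => [X _|]; last first.
  apply/poly_statZ/poly_statD; rewrite degE.
    by apply: poly_stat_sum => j; apply/poly_statZ/poly_stat_krawtchouk_del.
  by rewrite -(add1n (mdeg m)); apply: poly_statM Hc; apply: poly_stat_var.
have -> : \prod_(i < r) Ustat u X i ^+ n i =
          Ustat u X k * \prod_(i < r) Ustat u X i ^+ m i.
  rewrite nE (bigD1 k) //= [in RHS](bigD1 k) //= mnmDE mnm1E eqxx addn1 exprS.
  rewrite mulrA; congr (_ * _); apply: eq_bigr => i ik.
  by rewrite mnmDE mnm1E eq_sym (negPf ik) addn0.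
(* The parts x_j Q_m of the coefficients sum to U_k Q_m, by definition of U_k. *)
have recE : (m k).+1%:R * krawtchouk u n X =
    \sum_j u (lift ord0 k) j * e j X + Ustat u X k * krawtchouk u m X.
  rewrite mulr_natl {1}nE krawtchouk_rec mulr_suml -big_split /=.
  by apply: eq_bigr => j _; rewrite /e mulrBr mulrA subrK.
apply: (mulfI q0); rewrite mulVKf // [RHS]mulrBr recE.
by move: (m k).+1%:R q0 {g recE} => q q0; field.
Qed.

End LeadingTerm.

Theorem theorem4 (R : realFieldType) (N r : nat)
    (hN : (1 <= N)%N) (hd : (2 <= r.+1)%N)
    (p : 'I_r.+1 -> R) (p_gt0 : forall j, 0 < p j) (p_sum1 : \sum_j p j = 1)
    (u : 'I_r.+1 -> 'I_r.+1 -> R) (a : 'I_r.+1 -> R)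
    (u0 : forall j, u ord0 j = 1)
    (a_gt0 : forall l, 0 < a l)
    (u_orth : forall l m,
       \sum_(i < r.+1) u l i * u m i * p i = a l * (l == m)%:R)
    (n : 'X_{1..r}) (hn : (mdeg n <= N)%N) :
  exists (P : {mpoly R[r]}) (c : R),
    [/\ c != 0,
        forall X : 'I_r.+1 -> nat, (\sum_(j < r.+1) X j)%N = N ->
          krawtchouk u n X = P.@[Ustat u X]
      & forall m : 'X_{1..r},
          m \in msupp (P - c *: \prod_(k < r) 'X_k ^+ n k) ->
          (mdeg m < mdeg n)%N].
Proof.
have [c c0 [P sP QP]] := krawtchouk_leading (N := N) u0 a_gt0 u_orth n.
exists (P + c *: 'X_[n]), c; split=> // [X DX|m].
  by rewrite mevalD mevalZ mevalX -QP // subrK.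
by rewrite -mpolyXE_id addrK => /msize_mdeg_lt /leq_trans; apply.
Qed.
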